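(* Let $X$ be a real convex-transitive Banach space. Suppose that for each $\epsilon>0$ there exist $k\in\mathbb{N}$, numbers $\delta_1,\dots,\delta_k\in(0,1)$, numbers $c_1,\dots,c_k\in(0,1]$ with $\sum_{i=1}^k c_i=1$, and functionals $f_1,\dots,f_k\in S_{X^*}$ such that (1) $\{y\in B_X : f_i(y)>1-c_i\delta_i \text{ for all } 1\le i\le k\}\neq\emptyset$, and (2) $\operatorname{diam}\{y\in B_X : f_i(y)>1-2\delta_i \text{ for all } 1\le i\le k\}<\epsilon$. Then $X\in\mathcal{J}$, i.e. $X$ is almost transitive, uniformly convex and uniformly smooth.
   Context: All spaces are real Banach spaces. $B_X$ is the closed unit ball and $S_X$ the unit sphere. $\mathcal{G}_X$ is the group of surjective linear isometries of $X$; for $x\in S_X$, $\mathcal{G}_X(x)=\{T(x):T\in\mathcal{G}_X\}$. $X$ is almost transitive if $\overline{\mathcal{G}_X(x)}=S_X$ for all $x\in S_X$, and convex-transitive if $\overline{\mathrm{conv}}(\mathcal{G}_X(x))=B_X$ for all $x\in S_X$. $\mathcal{J}$ is the class of Banach spaces that are simultaneously almost transitive, uniformly convex and uniformly smooth. *)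

(* Defs.v *)
From Stdlib Require Import Reals List.
Open Scope R_scope.

Record NormedSpace := {
  V :> Type;
  vzero : V;
  vadd : V -> V -> V;
  vopp : V -> V;
  vscal : R -> V -> V;
  vnorm : V -> R;
  vadd_assoc : forall x y z, vadd x (vadd y z) = vadd (vadd x y) z;
  vadd_comm : forall x y, vadd x y = vadd y x;
  vadd_0 : forall x, vadd x vzero = x;
  vadd_opp : forall x, vadd x (vopp x) = vzero;
  vscal_1 : forall x, vscal 1 x = x;
  vscal_assoc : forall a b x, vscal a (vscal b x) = vscal (a * b) x;
  vscal_distr_v : forall a x y, vscal a (vadd x y) = vadd (vscal a x) (vscal a y);
  vscal_distr_r : forall a b x, vscal (a + b) x = vadd (vscal a x) (vscal b x);
  vnorm_nonneg : forall x, 0 <= vnorm x;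
  vnorm_eq0 : forall x, vnorm x = 0 -> x = vzero;
  vnorm_scal : forall a x, vnorm (vscal a x) = Rabs a * vnorm x;
  vnorm_triangle : forall x y, vnorm (vadd x y) <= vnorm x + vnorm y
}.

Arguments vzero {_}.
Arguments vadd {_} _ _.
Arguments vopp {_} _.
Arguments vscal {_} _ _.
Arguments vnorm {_} _.

Definition vsub {X : NormedSpace} (x y : X) : X := vadd x (vopp y).
Definition dist {X : NormedSpace} (x y : X) : R := vnorm (vsub x y).

Definition complete (X : NormedSpace) : Prop :=
  forall u : nat -> X,
    (forall eps, eps > 0 -> exists N, forall m n, (m >= N)%nat -> (n >= N)%nat ->
        dist (u m) (u n) < eps) ->
    exists l : X, forall eps, eps > 0 -> exists N, forall n, (n >= N)%nat ->
        dist (u n) l < eps.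

Definition BanachSpace (X : NormedSpace) : Prop := complete X.

Definition ball (X : NormedSpace) (x : X) : Prop := vnorm x <= 1.
Definition sphere (X : NormedSpace) (x : X) : Prop := vnorm x = 1.

Definition linear_map {X Y : NormedSpace} (T : X -> Y) : Prop :=
  (forall x y, T (vadd x y) = vadd (T x) (T y)) /\
  (forall a x, T (vscal a x) = vscal a (T x)).

Definition surj_lin_isometry {X : NormedSpace} (T : X -> X) : Prop :=
  linear_map T /\ (forall x, vnorm (T x) = vnorm x) /\
  (forall y, exists x, T x = y).

Definition orbit {X : NormedSpace} (x : X) (y : X) : Prop :=
  exists T, surj_lin_isometry T /\ T x = y.

Definition closure {X : NormedSpace} (A : X -> Prop) (y : X) : Prop :=
  forall eps, eps > 0 -> exists a, A a /\ dist y a < eps.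

Fixpoint comb {X : NormedSpace} (l : list (R * X)) : X :=
  match l with
  | nil => vzero
  | (c, a) :: l' => vadd (vscal c a) (comb l')
  end.

Fixpoint coef_sum {X : NormedSpace} (l : list (R * X)) : R :=
  match l with
  | nil => 0
  | (c, _) :: l' => c + coef_sum l'
  end.

Definition conv {X : NormedSpace} (A : X -> Prop) (y : X) : Prop :=
  exists l : list (R * X),
    (forall p, In p l -> 0 <= fst p /\ A (snd p)) /\
    coef_sum l = 1 /\ comb l = y.

Definition almost_transitive (X : NormedSpace) : Prop :=
  forall x : X, sphere X x -> forall y, closure (orbit x) y <-> sphere X y.

Definition convex_transitive (X : NormedSpace) : Prop :=
  forall x : X, sphere X x -> forall y, closure (conv (orbit x)) y <-> ball X y.

Definition uniformly_convex (X : NormedSpace) : Prop :=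
  forall eps, 0 < eps -> exists delta, 0 < delta /\
    forall x y : X, ball X x -> ball X y -> dist x y >= eps ->
      vnorm (vscal (/2) (vadd x y)) <= 1 - delta.

(* Uniform smoothness: rho_X(t)/t -> 0 as t -> 0+, where
   rho_X(t) = sup { (||x+ty|| + ||x-ty||)/2 - 1 : x, y in S_X }. *)
Definition uniformly_smooth (X : NormedSpace) : Prop :=
  forall eps, 0 < eps -> exists t0, 0 < t0 /\
    forall t, 0 < t < t0 -> forall x y : X, sphere X x -> sphere X y ->
      (vnorm (vadd x (vscal t y)) + vnorm (vsub x (vscal t y))) / 2 - 1 <= eps * t.

Definition class_J (X : NormedSpace) : Prop :=
  almost_transitive X /\ uniformly_convex X /\ uniformly_smooth X.

Definition linear_functional {X : NormedSpace} (f : X -> R) : Prop :=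
  (forall x y, f (vadd x y) = f x + f y) /\ (forall a x, f (vscal a x) = a * f x).

Definition dual_sphere (X : NormedSpace) (f : X -> R) : Prop :=
  linear_functional f /\
  is_lub (fun r => exists x : X, ball X x /\ r = Rabs (f x)) 1.

Fixpoint fsum (n : nat) (c : nat -> R) : R :=
  match n with
  | O => 0
  | S m => fsum m c + c m
  end.

Definition diam_lt {X : NormedSpace} (A : X -> Prop) (eps : R) : Prop :=
  exists d, is_lub (fun r => exists x y, A x /\ A y /\ r = dist x y) d /\ d < eps.

(* Main.v *)
From Stdlib Require Import Reals Lra Lia Classical List IndefiniteDescription.
Require Import Defs.
Open Scope R_scope.

(** Every orbit on the sphere meets the slice cut out by [sum_i f_i / delta_i], because a
    linear functional cannot be smaller at all points of a convex combination than at the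
    combination itself.  The slice is so thin that two points whose midpoint it contains
    are [eps]-close; this gives almost transitivity and uniform convexity.

    If the norm were not uniformly smooth, almost transitivity would spread its failure to
    every point: there is [c > 0] such that from any [x] a centered step of length [t] raises
    the expected norm by [c t].  Concatenating such steps keeps the growth rate [c], so the
    second moment of the total displacement over time [t] is at least [c^2 t^2]; but each
    doubling of the number of steps lowers it by a fixed multiple of [t^2], by uniform
    convexity, a contradiction. *)

(** * Vector arithmetic from the axioms *)

Lemma vadd_0_l (X : NormedSpace) (x : X) : vadd vzero x = x.
Proof. rewrite vadd_comm; apply vadd_0. Qed.

Lemma vscal_0_l (X : NormedSpace) (x : X) : vscal 0 x = vzero.
Proof. apply vnorm_eq0; rewrite vnorm_scal, Rabs_R0; ring. Qed.

Lemma vnorm_0 (X : NormedSpace) : vnorm (@vzero X) = 0.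
Proof. rewrite <- (vscal_0_l X vzero), vnorm_scal, Rabs_R0; ring. Qed.

Lemma vscal_0_r (X : NormedSpace) (a : R) : vscal a (@vzero X) = vzero.
Proof. apply vnorm_eq0; rewrite vnorm_scal, vnorm_0; ring. Qed.

Lemma vopp_scal (X : NormedSpace) (x : X) : vopp x = vscal (-1) x.
Proof.
  assert (E : vadd x (vscal (-1) x) = vzero).
  { rewrite <- (vscal_1 X x) at 1.
    rewrite <- vscal_distr_r, Rplus_opp_r; apply vscal_0_l. }
  rewrite <- (vadd_0 X (vopp x)), <- E, vadd_assoc, (vadd_comm X (vopp x)).
  now rewrite vadd_opp, vadd_0_l.
Qed.

(** * Deciding linear identities *)

(** Opposites need no constructor: [vec] first turns them into scalings by -1 through
    [vopp_scal]. *)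
Inductive vexp : Type :=
| VZero : vexp
| VAtom : nat -> vexp
| VAdd : vexp -> vexp -> vexp
| VScal : R -> vexp -> vexp.

Fixpoint veval {X : NormedSpace} (l : list X) (e : vexp) : X :=
  match e with
  | VZero => vzero
  | VAtom i => nth i l vzero
  | VAdd e1 e2 => vadd (veval l e1) (veval l e2)
  | VScal a e1 => vscal a (veval l e1)
  end.

Fixpoint vcoef (e : vexp) (i : nat) : R :=
  match e with
  | VZero => 0
  | VAtom j => if Nat.eqb i j then 1 else 0
  | VAdd e1 e2 => vcoef e1 i + vcoef e2 i
  | VScal a e1 => a * vcoef e1 i
  end.

Fixpoint lincomb {X : NormedSpace} (l : list X) (c : nat -> R) : X :=
  match l with
  | nil => vzero
  | v :: l' => vadd (vscal (c 0%nat) v) (lincomb l' (fun i => c (S i)))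
  end.

(** Recursion on the atom list lets [cbn] unfold this into one real equation per atom. *)
Fixpoint same_coefs {A : Type} (l : list A) (c d : nat -> R) : Prop :=
  match l with
  | nil => True
  | _ :: l' => c 0%nat = d 0%nat /\ same_coefs l' (fun i => c (S i)) (fun i => d (S i))
  end.

Lemma lincomb_ext (X : NormedSpace) (l : list X) :
  forall c d, same_coefs l c d -> lincomb l c = lincomb l d.
Proof.
  induction l as [|v l IH]; intros c d H; simpl in *; [reflexivity|].
  destruct H as [H1 H2]; now rewrite H1, (IH _ _ H2).
Qed.

Lemma lincomb_zero (X : NormedSpace) (l : list X) : lincomb l (fun _ => 0) = vzero.
Proof.
  induction l as [|v l IH]; simpl; [reflexivity|].
  now rewrite IH, vscal_0_l, vadd_0.
Qed.

Lemma lincomb_add (X : NormedSpace) (l : list X) : forall c d,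
  lincomb l (fun i => c i + d i) = vadd (lincomb l c) (lincomb l d).
Proof.
  induction l as [|v l IH]; intros c d; simpl; [now rewrite vadd_0|].
  rewrite (IH (fun i => c (S i)) (fun i => d (S i))), vscal_distr_r.
  rewrite <- !vadd_assoc; f_equal.
  rewrite (vadd_assoc X (vscal (d 0%nat) v)), (vadd_comm X (vscal (d 0%nat) v)).
  now rewrite <- vadd_assoc.
Qed.

Lemma lincomb_scal (X : NormedSpace) (a : R) (l : list X) : forall c,
  lincomb l (fun i => a * c i) = vscal a (lincomb l c).
Proof.
  induction l as [|v l IH]; intros c; simpl; [now rewrite vscal_0_r|].
  now rewrite (IH (fun i => c (S i))), vscal_distr_v, vscal_assoc.
Qed.

Lemma lincomb_atom (X : NormedSpace) (l : list X) : forall j,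
  lincomb l (fun i => if Nat.eqb i j then 1 else 0) = nth j l vzero.
Proof.
  induction l as [|v l IH]; intros [|j]; simpl; try reflexivity.
  - now rewrite lincomb_zero, vscal_1, vadd_0.
  - now rewrite IH, vscal_0_l, vadd_0_l.
Qed.

Lemma veval_lincomb (X : NormedSpace) (l : list X) (e : vexp) :
  veval l e = lincomb l (vcoef e).
Proof.
  induction e as [|j|e1 IH1 e2 IH2|a e1 IH1]; simpl.
  - symmetry; apply lincomb_zero.
  - symmetry; apply lincomb_atom.
  - rewrite IH1, IH2; symmetry; apply lincomb_add.
  - rewrite IH1; symmetry; apply lincomb_scal.
Qed.

Lemma veval_eq (X : NormedSpace) (l : list X) (e1 e2 : vexp) :
  same_coefs l (vcoef e1) (vcoef e2) -> veval l e1 = veval l e2.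
Proof. intros H; rewrite !veval_lincomb; now apply lincomb_ext. Qed.

Ltac vinsert x l :=
  lazymatch l with
  | nil => constr:(x :: nil)
  | x :: _ => l
  | ?y :: ?l' => let l'' := vinsert x l' in constr:(y :: l'')
  end.

Ltac vindex x l :=
  lazymatch l with
  | x :: _ => constr:(0%nat)
  | _ :: ?l' => let n := vindex x l' in constr:(S n)
  end.

Ltac vatoms e l :=
  lazymatch e with
  | vzero => l
  | vadd ?a ?b => let l' := vatoms a l in vatoms b l'
  | vscal _ ?a => vatoms a l
  | ?x => vinsert x l
  end.

Ltac vreify e l :=
  lazymatch e with
  | vzero => constr:(VZero)
  | vadd ?a ?b => let a' := vreify a l in let b' := vreify b l in constr:(VAdd a' b')
  | vscal ?r ?a => let a' := vreify a l in constr:(VScal r a')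
  | ?x => let n := vindex x l in constr:(VAtom n)
  end.

(** Both sides are reified over one common list of atoms; the coefficient equations that remain go
    to [lra] or [field]. *)
Ltac vec :=
  unfold dist, vsub; rewrite ?vopp_scal;
  lazymatch goal with
  | |- @eq (V ?X) ?a ?b =>
      let l0 := constr:(@nil (V X)) in
      let l1 := vatoms a l0 in
      let l := vatoms b l1 in
      let a' := vreify a l in
      let b' := vreify b l in
      change (veval l a' = veval l b'); apply veval_eq;
      cbn [same_coefs vcoef Nat.eqb]; repeat split; try lra; try (field; lra)
  end.

(** * Norms, functionals and isometries *)

Lemma vnorm_opp (X : NormedSpace) (x : X) : vnorm (vopp x) = vnorm x.
Proof. rewrite vopp_scal, vnorm_scal, Rabs_left by lra; ring. Qed.

Lemma dist_sym (X : NormedSpace) (x y : X) : dist x y = dist y x.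
Proof.
  unfold dist; rewrite <- vnorm_opp; f_equal; vec.
Qed.

Lemma vnorm_le_dist (X : NormedSpace) (x y : X) : vnorm x <= vnorm y + dist x y.
Proof.
  replace x with (vadd y (vsub x y)) at 1 by vec.
  apply vnorm_triangle.
Qed.

Lemma vnorm_scal_pos (X : NormedSpace) (a : R) (x : X) :
  0 <= a -> vnorm (vscal a x) = a * vnorm x.
Proof. intros H; rewrite vnorm_scal, Rabs_pos_eq; auto. Qed.

Lemma sphere_normalize (X : NormedSpace) (x : X) :
  0 < vnorm x -> sphere X (vscal (/ vnorm x) x).
Proof.
  intros H; unfold sphere.
  rewrite vnorm_scal_pos; [field; lra|].
  left; now apply Rinv_0_lt_compat.
Qed.

Lemma linear_functional_sub (X : NormedSpace) (f : X -> R) (x y : X) :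
  linear_functional f -> f (vsub x y) = f x - f y.
Proof.
  intros [Ha Hs]; unfold vsub; rewrite vopp_scal, Ha, Hs; ring.
Qed.

Lemma dual_sphere_bound (X : NormedSpace) (f : X -> R) (x : X) :
  dual_sphere X f -> Rabs (f x) <= vnorm x.
Proof.
  intros [[Ha Hs] [Hub _]].
  destruct (Rle_lt_or_eq_dec _ _ (vnorm_nonneg X x)) as [Hp|H0].
  - assert (Hb : Rabs (f (vscal (/ vnorm x) x)) <= 1).
    { apply Hub; exists (vscal (/ vnorm x) x); split; [|reflexivity].
      unfold ball; rewrite (sphere_normalize X x Hp); lra. }
    rewrite Hs, Rabs_mult, Rabs_pos_eq in Hb
      by (left; now apply Rinv_0_lt_compat).
    apply (Rmult_le_compat_l (vnorm x)) in Hb; [|lra].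
    rewrite <- Rmult_assoc, Rinv_r in Hb; lra.
  - symmetry in H0; rewrite (vnorm_eq0 X x H0), vnorm_0.
    rewrite <- (vscal_0_l X vzero), Hs, Rmult_0_l, Rabs_R0; lra.
Qed.

Lemma linear_map_sub (X Y : NormedSpace) (T : X -> Y) (x y : X) :
  linear_map T -> T (vsub x y) = vsub (T x) (T y).
Proof.
  intros [Ha Hs]; unfold vsub; now rewrite !vopp_scal, Ha, Hs.
Qed.

Lemma isometry_dist (X : NormedSpace) (T : X -> X) (x y : X) :
  surj_lin_isometry T -> dist (T x) (T y) = dist x y.
Proof.
  intros [Hl [Hn _]]; unfold dist.
  now rewrite <- linear_map_sub, Hn.
Qed.

(** Choice picks preimages; preservation of norms makes [T] injective, and injectivity carries
    linearity over to [S]. *)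
Lemma isometry_inverse (X : NormedSpace) (T : X -> X) :
  surj_lin_isometry T -> exists S, surj_lin_isometry S /\ forall y, T (S y) = y.
Proof.
  intros HT; pose proof HT as [[Ha Hs] [Hn Hsurj]].
  destruct (functional_choice _ Hsurj) as [S HS].
  assert (inj : forall x y, T x = T y -> x = y).
  { intros x y E.
    assert (D : vsub x y = vzero).
    { apply vnorm_eq0; change (dist x y = 0).
      rewrite <- (isometry_dist X T x y HT), E; unfold dist, vsub.
      rewrite vadd_opp; apply vnorm_0. }
    replace x with (vadd y (vsub x y)) by vec; now rewrite D, vadd_0. }
  exists S; split; [|exact HS].
  split; [split|split].
  - intros x y; apply inj; now rewrite Ha, !HS.
  - intros a x; apply inj; now rewrite Hs, !HS.
  - intros x; now rewrite <- Hn, HS.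
  - intros y; exists (T y); apply inj; now rewrite HS.
Qed.

Lemma isometry_comp (X : NormedSpace) (S T : X -> X) :
  surj_lin_isometry S -> surj_lin_isometry T -> surj_lin_isometry (fun x => S (T x)).
Proof.
  intros [[Sa Ss] [Sn Sj]] [[Ta Ts] [Tn Tj]].
  split; [split|split].
  - intros x y; now rewrite Ta, Sa.
  - intros a x; now rewrite Ts, Ss.
  - intros x; now rewrite Sn, Tn.
  - intros y; destruct (Sj y) as [z <-]; destruct (Tj z) as [x <-]; now exists x.
Qed.

(** * Slices met by every orbit *)

Lemma fsum_le (g h : nat -> R) (k : nat) :
  (forall i, (i < k)%nat -> g i <= h i) -> fsum k g <= fsum k h.
Proof.
  induction k as [|k IH]; intros H; simpl; [lra|].
  specialize (IH (fun i Hi => H i (Nat.lt_lt_succ_r _ _ Hi))).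
  specialize (H k (Nat.lt_succ_diag_r k)); lra.
Qed.

Lemma fsum_lt (g h : nat -> R) (k : nat) :
  (0 < k)%nat -> (forall i, (i < k)%nat -> g i < h i) -> fsum k g < fsum k h.
Proof.
  destruct k as [|k]; [lia|]; intros _ H; simpl.
  assert (fsum k g <= fsum k h).
  { apply fsum_le; intros i Hi; left; apply H; lia. }
  specialize (H k (Nat.lt_succ_diag_r k)); lra.
Qed.

Lemma fsum_minus (g h : nat -> R) (k : nat) :
  fsum k (fun i => g i - h i) = fsum k g - fsum k h.
Proof. induction k as [|k IH]; simpl; lra. Qed.

Lemma fsum_nonneg (g : nat -> R) (k : nat) :
  (forall i, (i < k)%nat -> 0 <= g i) -> 0 <= fsum k g.
Proof.
  induction k as [|k IH]; intros H; simpl; [lra|].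
  specialize (IH (fun i Hi => H i (Nat.lt_lt_succ_r _ _ Hi))).
  specialize (H k (Nat.lt_succ_diag_r k)); lra.
Qed.

Lemma fsum_term_le (g : nat -> R) (k j : nat) :
  (forall i, (i < k)%nat -> 0 <= g i) -> (j < k)%nat -> g j <= fsum k g.
Proof.
  induction k as [|k IH]; intros H Hj; simpl; [lia|].
  assert (Hk := H k (Nat.lt_succ_diag_r k)).
  assert (H' : forall i, (i < k)%nat -> 0 <= g i) by (intros; apply H; lia).
  destruct (Nat.eq_dec j k) as [->|n].
  - assert (P := fsum_nonneg g k H'); lra.
  - assert (P := IH H' ltac:(lia)); lra.
Qed.

Lemma fsum_linear (X : NormedSpace) (f : nat -> X -> R) (w : nat -> R) (k : nat) :
  (forall i, (i < k)%nat -> linear_functional (f i)) ->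
  linear_functional (fun x => fsum k (fun i => w i * f i x)).
Proof.
  intros H; split.
  - intros x y; induction k as [|k IH]; simpl; [lra|].
    rewrite IH by (intros; apply H; lia).
    destruct (H k (Nat.lt_succ_diag_r k)) as [Ha _]; rewrite Ha; ring.
  - intros a x; induction k as [|k IH]; simpl; [lra|].
    rewrite IH by (intros; apply H; lia).
    destruct (H k (Nat.lt_succ_diag_r k)) as [_ Hs]; rewrite Hs; ring.
Qed.

Lemma fsum_bounded (X : NormedSpace) (f : nat -> X -> R) (w : nat -> R) (k : nat) (x : X) :
  (forall i, (i < k)%nat -> 0 <= w i /\ Rabs (f i x) <= vnorm x) ->
  Rabs (fsum k (fun i => w i * f i x)) <= fsum k w * vnorm x.
Proof.
  induction k as [|k IH]; intros H; simpl; [rewrite Rabs_R0; lra|].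
  eapply Rle_trans; [apply Rabs_triang|].
  specialize (IH (fun i Hi => H i (Nat.lt_lt_succ_r _ _ Hi))).
  destruct (H k (Nat.lt_succ_diag_r k)) as [H1 H2].
  rewrite Rabs_mult, (Rabs_pos_eq (w k)) by assumption.
  assert (w k * Rabs (f k x) <= w k * vnorm x) by (apply Rmult_le_compat_l; lra).
  lra.
Qed.

Lemma conv_functional_le (X : NormedSpace) (A : X -> Prop) (f : X -> R) (z : X) :
  linear_functional f -> conv A z -> exists a, A a /\ f z <= f a.
Proof.
  intros [Ha Hs] [l [Hl [H1 <-]]].
  apply NNPP; intros N.
  assert (Hlt : forall a, A a -> f a < f (comb l)).
  { intros a HA; apply Rnot_le_lt; intros C; apply N; now exists a. }
  set (m := f (comb l)) in *.
  (* Coefficients may vanish, so strictness can only be claimed once the partial sum is positive;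
     the weak bound carries the induction until then. *)
  assert (P : f (comb l) <= m * coef_sum l /\ (0 < coef_sum l -> f (comb l) < m * coef_sum l)).
  { clear N H1; clearbody m; induction l as [|[c a] l IH]; simpl.
    - rewrite <- (vscal_0_l X vzero), Hs; lra.
    - rewrite Ha, Hs.
      destruct IH as [I1 I2]; [intros p Hp; apply Hl; now right|].
      destruct (Hl (c, a) (or_introl eq_refl)) as [Hc HA]; simpl in Hc, HA.
      specialize (Hlt a HA).
      destruct Hc as [Hc|Hc].
      + assert (c * f a < c * m) by (apply Rmult_lt_compat_l; lra).
        split; intros; lra.
      + subst c; split; intros; [lra|].
        assert (f (comb l) < m * coef_sum l) by (apply I2; lra); lra. }
  destruct P as [_ P]; fold m in P; rewrite H1 in P; lra.
Qed.

(** Convertible to the body of the hypothesis of [theorem4], which can therefore be passed on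
    unchanged. *)
Definition diametral_hypothesis (X : NormedSpace) (eps : R) : Prop :=
  exists (k : nat) (delta c : nat -> R) (f : nat -> X -> R),
    (forall i, (i < k)%nat -> 0 < delta i < 1) /\
    (forall i, (i < k)%nat -> 0 < c i <= 1) /\
    fsum k c = 1 /\
    (forall i, (i < k)%nat -> dual_sphere X (f i)) /\
    (exists y : X, ball X y /\
       forall i, (i < k)%nat -> f i y > 1 - c i * delta i) /\
    diam_lt (fun y : X => ball X y /\
       forall i, (i < k)%nat -> f i y > 1 - 2 * delta i) eps.

(* The functional is [sum_i f_i / delta_i] and the level is [sum_i 1 / delta_i - 1]:
   above that level every deficit [(1 - f_i) / delta_i] is smaller than [1]. *)
Lemma single_functional (X : NormedSpace) (eps : R) :
  diametral_hypothesis X eps ->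
  exists (phi : X -> R) (M C : R),
    linear_functional phi /\ 0 <= M /\ (forall x, Rabs (phi x) <= M * vnorm x) /\
    (exists y, ball X y /\ C < phi y) /\
    (forall x y, ball X x -> ball X y -> C < phi (vscal (/2) (vadd x y)) ->
       dist x y < eps).
Proof.
  intros (k & delta & c & f & Hd & Hc & Hsum & Hf & [y [By Hy]] & [d [[Hub _] Hdiam]]).
  assert (Hw : forall i, (i < k)%nat -> 0 < / delta i).
  { intros i Hi; apply Rinv_0_lt_compat, Hd, Hi. }
  exists (fun x => fsum k (fun i => / delta i * f i x)), (fsum k (fun i => / delta i)),
    (fsum k (fun i => / delta i) - 1).
  split; [|split; [|split; [|split]]].
  - apply fsum_linear; intros i Hi; apply Hf, Hi.
  - apply fsum_nonneg; intros i Hi; left; auto.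
  - intros x; apply fsum_bounded; intros i Hi; split; [left; auto|].
    apply dual_sphere_bound; auto.
  - exists y; split; [exact By|].
    (* Writing the 1 in the level as the sum of the [c i] reduces the claim to the termwise bounds
       on [f i y], each divided by [delta i]. *)
    rewrite <- Hsum, <- fsum_minus.
    apply fsum_lt; [destruct k; [simpl in Hsum; lra|lia]|].
    intros i Hi; specialize (Hy i Hi); specialize (Hd i Hi); specialize (Hw i Hi).
    replace (/ delta i - c i) with (/ delta i * (1 - c i * delta i)) by (field; lra).
    apply Rmult_lt_compat_l; lra.
  - intros u v Bu Bv Hm.
    set (m := vscal (/2) (vadd u v)) in *.
    assert (Bf : forall i z, (i < k)%nat -> ball X z -> f i z <= 1).
    { intros i z Hi Bz; eapply Rle_trans; [apply Rle_abs|].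
      eapply Rle_trans; [apply dual_sphere_bound; auto|exact Bz]. }
    assert (Bm : ball X m).
    { unfold ball, m in *; rewrite vnorm_scal_pos by lra.
      assert (T := vnorm_triangle X u v); lra. }
    assert (Hfm : forall i, (i < k)%nat -> 1 - delta i < f i m).
    { intros j Hj.
      assert (P : / delta j - / delta j * f j m <= fsum k (fun i => / delta i - / delta i * f i m)).
      { apply (fsum_term_le (fun i => / delta i - / delta i * f i m)); [|exact Hj].
        intros i Hi; specialize (Bf i m Hi Bm); specialize (Hw i Hi).
        assert (/ delta i * f i m <= / delta i * 1) by (apply Rmult_le_compat_l; lra); lra. }
      rewrite fsum_minus in P.
      specialize (Hw j Hj); specialize (Hd j Hj).
      assert (Q : / delta j - / delta j * f j m < 1) by lra.
      apply (Rmult_lt_compat_l (delta j)) in Q; [|lra].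
      replace (delta j * (/ delta j - / delta j * f j m)) with (1 - f j m) in Q
        by (field; lra); lra. }
    eapply Rle_lt_trans; [apply Hub; exists u, v|exact Hdiam].
    (* As [f i <= 1] on the ball, a midpoint value above [1 - delta i] forces both endpoint values
       above [1 - 2 * delta i]. *)
    assert (Hmid : forall i, (i < k)%nat -> f i m = / 2 * (f i u + f i v)).
    { intros i Hi; destruct (Hf i Hi) as [[Ha Hs] _]; unfold m; now rewrite Hs, Ha. }
    split; [|split; [|reflexivity]]; (split; [assumption|]); intros i Hi;
      specialize (Hfm i Hi); rewrite (Hmid i Hi) in Hfm;
      assert (Hu := Bf i u Hi Bu); assert (Hv := Bf i v Hi Bv); lra.
Qed.

Lemma orbit_meets_slice (X : NormedSpace) (phi : X -> R) (M C : R) (y x : X) :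
  convex_transitive X -> linear_functional phi ->
  0 <= M -> (forall x, Rabs (phi x) <= M * vnorm x) ->
  ball X y -> C < phi y -> sphere X x ->
  exists T, surj_lin_isometry T /\ C < phi (T x).
Proof.
  intros Hct Hl HM Hb By Hy Sx.
  (* At this distance [phi] drops by less than [phi y - C]; [M + 1] avoids dividing by zero, as [M]
     may be 0. *)
  destruct (proj2 (Hct x Sx y) By ((phi y - C) / (M + 1))) as [z [Hz Dz]].
  { apply Rdiv_lt_0_compat; lra. }
  destruct (conv_functional_le X _ phi z Hl Hz) as [a [[T [HT <-]] Ha]].
  exists T; split; [exact HT|].
  apply (Rmult_lt_compat_l (M + 1)) in Dz; [|lra].
  replace ((M + 1) * ((phi y - C) / (M + 1))) with (phi y - C) in Dz by (field; lra).
  assert (B := Hb (vsub y z)); rewrite linear_functional_sub in B by assumption.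
  assert (A := Rle_abs (phi y - phi z)).
  assert (N := vnorm_nonneg X (vsub y z)).
  unfold dist in Dz; lra.
Qed.

Lemma almost_transitive_of_slices (X : NormedSpace) :
  convex_transitive X -> (forall eps, eps > 0 -> diametral_hypothesis X eps) ->
  almost_transitive X.
Proof.
  intros Hct H x Sx y; split.
  - intros Hy; unfold sphere in *.
    apply cond_eq; intros eps Heps.
    destruct (Hy eps Heps) as [a [[T [[_ [HT _]] <-]] D]].
    rewrite <- Sx, <- (HT x).
    assert (D1 := vnorm_le_dist X y (T x)).
    assert (D2 := vnorm_le_dist X (T x) y); rewrite dist_sym in D2.
    apply Rabs_def1; lra.
  - intros Sy eps Heps.
    destruct (single_functional X eps (H eps Heps))
      as (phi & M & C & Hl & HM & Hb & [y0 [By0 Hy0]] & Hdiam).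
    (* Once [T x] and [S y] lie in the same slice, so does their midpoint; hence they are close, and
       applying the inverse of [S] brings [x] close to [y]. *)
    destruct (orbit_meets_slice X phi M C y0 x Hct Hl HM Hb By0 Hy0 Sx) as [T [HT Tx]].
    destruct (orbit_meets_slice X phi M C y0 y Hct Hl HM Hb By0 Hy0 Sy) as [S [HS Ty]].
    destruct (isometry_inverse X S HS) as [S' [HS' SS']].
    exists (S' (T x)); split.
    + exists (fun x => S' (T x)); split; [now apply isometry_comp|reflexivity].
    + rewrite <- (isometry_dist X S) by assumption; rewrite SS'.
      apply Hdiam.
      * unfold ball; destruct HS as [_ [-> _]]; unfold sphere in Sy; lra.
      * unfold ball; destruct HT as [_ [-> _]]; unfold sphere in Sx; lra.
      * destruct Hl as [Ha Hs]; rewrite Hs, Ha; lra.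
Qed.

(** A midpoint of norm close to 1 is normalized and moved into a slice of slightly higher level;
    undoing the normalization costs so little that the moved midpoint stays above [C]. *)
Lemma uniformly_convex_of_slices (X : NormedSpace) :
  convex_transitive X -> (forall eps, eps > 0 -> diametral_hypothesis X eps) ->
  uniformly_convex X.
Proof.
  intros Hct H eps Heps.
  destruct (single_functional X eps (H eps Heps))
    as (phi & M & C & Hl & HM & Hb & [y0 [By0 Hy0]] & Hdiam).
  set (s := (phi y0 - C) / 2).
  assert (Hs : 0 < s) by (unfold s; lra).
  (* The bound [/2] keeps the midpoint away from 0; the other gives [M * d <= s], the loss allowed
     in [phi]. *)
  set (d := Rmin (/2) (s / (M + 1))).
  assert (Hd2 : d <= s / (M + 1)) by apply Rmin_r.
  assert (Hd1 : d <= / 2) by apply Rmin_l.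
  assert (Hd : 0 < d).
  { apply Rmin_glb_lt; [lra|]; apply Rdiv_lt_0_compat; lra. }
  exists d; split; [exact Hd|].
  intros x y Bx By Dxy.
  apply Rnot_lt_le; intros Hm.
  set (m := vscal (/2) (vadd x y)) in *.
  assert (Hmp : 0 < vnorm m) by lra.
  assert (Hm1 : vnorm m <= 1).
  { unfold ball, m in *; rewrite vnorm_scal_pos by lra.
    assert (T := vnorm_triangle X x y); lra. }
  destruct (orbit_meets_slice X phi M (C + s) y0 (vscal (/ vnorm m) m) Hct Hl HM Hb By0)
    as [T [HT Tm]]; [unfold s; lra|now apply sphere_normalize|].
  destruct HT as [[Ta Ts] [Tn Tj]].
  destruct Hl as [Ha Hsc].
  assert (Hphi : C < phi (T m)).
  { rewrite Ts, Hsc in Tm.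
    assert (B := Hb (T m)); rewrite Tn in B.
    assert (A := Rle_abs (- phi (T m))); rewrite Rabs_Ropp in A.
    assert (A' := Rle_abs (phi (T m))).
    assert (E : (/ vnorm m - 1) * phi (T m) <= M * d).
    { assert (0 <= / vnorm m - 1).
      { apply (Rmult_le_reg_l (vnorm m)); [lra|].
        rewrite Rmult_minus_distr_l, Rinv_r; lra. }
      apply Rle_trans with ((/ vnorm m - 1) * (M * vnorm m)).
      - apply Rmult_le_compat_l; lra.
      - replace ((/ vnorm m - 1) * (M * vnorm m)) with (M * (1 - vnorm m)) by (field; lra).
        apply Rmult_le_compat_l; lra. }
    assert (M * d <= s).
    { apply Rle_trans with ((M + 1) * d); [lra|].
      apply (Rmult_le_compat_l (M + 1)) in Hd2; [|lra].
      replace ((M + 1) * (s / (M + 1))) with s in Hd2 by (field; lra); lra. }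
    lra. }
  assert (D : dist (T x) (T y) < eps).
  { apply Hdiam; [unfold ball; now rewrite Tn..|].
    now rewrite <- Ta, <- Ts. }
  rewrite isometry_dist in D by (repeat split; auto); lra.
Qed.

(** * Uniform convexity excludes roughness *)

(** Required at every vector and every step length, so that a walk can continue from wherever it has
    arrived. *)
Definition rough (X : NormedSpace) (c : R) : Prop :=
  forall (x : X) (t : R), 0 < t -> exists y, vnorm y <= 1 /\
    vnorm x + c * t <= (vnorm (vadd x (vscal t y)) + vnorm (vsub x (vscal t y))) / 2.

(** A homogeneous quadratic form of uniform convexity, suited to averaging: the parallelogram defect
    controls the squared distance up to a small error. *)
Lemma uniformly_convex_square (X : NormedSpace) (eta : R) :
  uniformly_convex X -> 0 < eta ->
  exists K, 0 < K /\ forall a b : X,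
    (dist a b)^2 <= eta * ((vnorm a)^2 + (vnorm b)^2) +
      K * (2 * ((vnorm a)^2 + (vnorm b)^2) - (vnorm (vadd a b))^2).
Proof.
  intros HU Heta.
  (* Chosen so that [e * e <= eta]: a squared distance of at least [eta * (vnorm a)^2] then means a
     distance of at least [e * vnorm a]. *)
  set (e := Rmin 1 eta).
  assert (He : 0 < e) by (apply Rmin_glb_lt; lra).
  assert (He2 : e * e <= eta).
  { assert (e <= 1) by apply Rmin_l; assert (e <= eta) by apply Rmin_r; nra. }
  destruct (HU e He) as [d0 [Hd0 HUC]].
  set (d := Rmin 1 d0).
  assert (Hd : 0 < d) by (apply Rmin_glb_lt; lra).
  assert (Hd1 : d <= 1) by apply Rmin_l.
  assert (Hdd : d <= d0) by apply Rmin_r.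
  set (q := d * d / 4).
  assert (Hq : 0 < q) by (unfold q; nra).
  assert (Key : forall a b : X, vnorm b <= vnorm a ->
    eta * ((vnorm a)^2 + (vnorm b)^2) <= (dist a b)^2 ->
    (vnorm (vadd a b))^2 <= 2 * (1 - q) * ((vnorm a)^2 + (vnorm b)^2)).
  { intros a b Hba Hdist.
    assert (Na := vnorm_nonneg X a); assert (Nb := vnorm_nonneg X b).
    assert (Ns := vnorm_nonneg X (vadd a b)); assert (Nt := vnorm_triangle X a b).
    (* If the norms differ much, [(vnorm a - vnorm b)^2] alone supplies the defect, whence
       [q = d * d / 4]. Otherwise dividing by [vnorm a] brings both vectors into the ball and
       uniform convexity applies. *)
    destruct (Rle_lt_dec (vnorm b) ((1 - d) * vnorm a)) as [Hs|Hs].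
    - assert ((vnorm (vadd a b))^2 <= (vnorm a + vnorm b)^2) by (apply pow_incr; lra).
      assert ((d * vnorm a)^2 <= (vnorm a - vnorm b)^2) by (apply pow_incr; nra).
      assert (d * d * (vnorm b)^2 <= d * d * (vnorm a)^2)
        by (apply Rmult_le_compat_l; [nra|apply pow_incr; lra]).
      unfold q; lra.
    - assert (Hap : 0 < vnorm a) by nra.
      assert (Hi : 0 < / vnorm a) by (now apply Rinv_0_lt_compat).
      assert (Hae : e * vnorm a <= dist a b).
      { apply Rnot_lt_le; intros C.
        assert (0 <= dist a b) by apply vnorm_nonneg.
        assert (e * vnorm a * (e * vnorm a) <= eta * (vnorm a)^2) by nra.
        nra. }
      assert (U : vnorm (vscal (/2) (vadd (vscal (/ vnorm a) a) (vscal (/ vnorm a) b))) <= 1 - d0).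
      { apply HUC.
        - unfold ball; rewrite (sphere_normalize X a Hap); lra.
        - unfold ball; rewrite vnorm_scal_pos by lra.
          apply (Rmult_le_reg_l (vnorm a)); [lra|].
          rewrite <- Rmult_assoc, Rinv_r; lra.
        - replace (dist (vscal (/ vnorm a) a) (vscal (/ vnorm a) b))
            with (/ vnorm a * dist a b).
          + apply Rle_ge, (Rmult_le_reg_l (vnorm a)); [lra|].
            rewrite <- Rmult_assoc, Rinv_r; lra.
          + unfold dist; rewrite <- vnorm_scal_pos by lra; f_equal; vec. }
      replace (vscal (/2) (vadd (vscal (/ vnorm a) a) (vscal (/ vnorm a) b)))
        with (vscal (/2 * / vnorm a) (vadd a b)) in U by vec.
      rewrite vnorm_scal_pos in U by nra.
      assert (U' : vnorm (vadd a b) <= 2 * (1 - d) * vnorm a).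
      { apply (Rmult_le_compat_l (2 * vnorm a)) in U; [|lra].
        replace (2 * vnorm a * (/ 2 * / vnorm a * vnorm (vadd a b)))
          with (vnorm (vadd a b)) in U by (field; lra). nra. }
      assert ((vnorm (vadd a b))^2 <= (2 * (1 - d) * vnorm a)^2) by (apply pow_incr; lra).
      assert (((1 - d) * vnorm a)^2 <= (vnorm b)^2) by (apply pow_incr; nra).
      assert (2 * (1 - d) * (1 - d) * (vnorm a)^2 <= (1 - d) * ((vnorm a)^2 + (vnorm b)^2)).
      { assert (1 + (1 - d)^2 >= 2 * (1 - d)) by nra.
        assert ((vnorm a)^2 + (vnorm b)^2 >= 2 * (1 - d) * (vnorm a)^2) by nra. nra. }
      assert (q <= d) by (unfold q; nra).
      nra. }
  assert (Key' : forall a b : X,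
    eta * ((vnorm a)^2 + (vnorm b)^2) <= (dist a b)^2 ->
    (vnorm (vadd a b))^2 <= 2 * (1 - q) * ((vnorm a)^2 + (vnorm b)^2)).
  { intros a b Hab; destruct (Rle_dec (vnorm b) (vnorm a)).
    - now apply Key.
    - rewrite vadd_comm, (Rplus_comm (_ ^ 2)); apply Key; [lra|].
      now rewrite dist_sym, Rplus_comm. }
  exists (/ q); split; [now apply Rinv_0_lt_compat|].
  intros a b.
  assert (Na := vnorm_nonneg X a); assert (Nb := vnorm_nonneg X b).
  assert (0 < / q) by (now apply Rinv_0_lt_compat).
  set (S := (vnorm a)^2 + (vnorm b)^2) in *.
  assert (HS : 0 <= S) by (unfold S; nra).
  (* For a large distance the defect is at least [2 * q * S], while the squared distance is at most
     [2 * S]; for a small one the [eta] term suffices, the defect being nonnegative. *)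
  destruct (Rle_lt_dec (eta * S) ((dist a b)^2)) as [Hl|Hl].
  - specialize (Key' a b Hl); fold S in Key'.
    assert (0 <= dist a b) by apply vnorm_nonneg.
    assert (dist a b <= vnorm a + vnorm b).
    { unfold dist, vsub; rewrite <- (vnorm_opp X b); apply vnorm_triangle. }
    assert ((dist a b)^2 <= (vnorm a + vnorm b)^2) by (apply pow_incr; lra).
    assert (0 <= (vnorm a - vnorm b)^2) by apply pow2_ge_0.
    assert ((dist a b)^2 <= 2 * S) by (unfold S; lra).
    assert (/ q * (2 * q * S) <= / q * (2 * S - (vnorm (vadd a b))^2))
      by (apply Rmult_le_compat_l; lra).
    replace (/ q * (2 * q * S)) with (2 * S) in * by (field; lra).
    assert (0 <= eta * S) by (apply Rmult_le_pos; lra).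
    lra.
  - assert ((vnorm (vadd a b))^2 <= (vnorm a + vnorm b)^2).
    { apply pow_incr; split; [apply vnorm_nonneg|apply vnorm_triangle]. }
    assert (0 <= 2 * S - (vnorm (vadd a b))^2).
    { assert (0 <= (vnorm a - vnorm b)^2) by apply pow2_ge_0.
      unfold S; lra. }
    assert (0 <= / q * (2 * S - (vnorm (vadd a b))^2)) by (apply Rmult_le_pos; lra).
    lra.
Qed.

(* The expectation of a random vector; [mean_centered] is the only consequence of
   the vector being centered that the argument needs, and it survives conditioning. *)
Record mean {X : NormedSpace} (E : (X -> R) -> R) : Prop := {
  mean_linear : forall g h r, E (fun a => g a + r * h a) = E g + r * E h;
  mean_const : forall r, E (fun _ => r) = r;
  mean_mono : forall g h, (forall a, g a <= h a) -> E g <= E h;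
  mean_centered : forall v, vnorm v <= E (fun a => vnorm (vadd v a))
}.

(** Average the tangent-line bound for the square at the point [E h]. *)
Lemma mean_square (X : NormedSpace) (E : (X -> R) -> R) (h : X -> R) :
  mean E -> (E h)^2 <= E (fun a => (h a)^2).
Proof.
  intros HE.
  assert (P : E (fun a => - (E h)^2 + 2 * E h * h a) <= E (fun a => (h a)^2)).
  { apply mean_mono; [assumption|]; intros a.
    assert (0 <= (h a - E h)^2) by apply pow2_ge_0; nra. }
  rewrite mean_linear, mean_const in P by assumption; nra.
Qed.

Lemma mean_growth_le (X : NormedSpace) (E : (X -> R) -> R) (x : X) :
  mean E -> E (fun a => vnorm (vadd x a)) <= vnorm x + E vnorm.
Proof.
  intros HE.
  apply Rle_trans with (E (fun a => vnorm x + 1 * vnorm a)).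
  - apply mean_mono; [assumption|]; intros a.
    rewrite Rmult_1_l; apply vnorm_triangle.
  - rewrite mean_linear, mean_const by assumption; lra.
Qed.

(** The law of [a + b] where [b] is drawn from [F a] once [a] is known. *)
Lemma mean_bind (X : NormedSpace) (E : (X -> R) -> R) (F : X -> (X -> R) -> R) :
  mean E -> (forall a, mean (F a)) ->
  mean (fun h => E (fun a => F a (fun b => h (vadd a b)))).
Proof.
  intros HE HF; split.
  - intros g h r.
    (* Monotonicity in both directions stands in for rewriting under [E]. *)
    rewrite <- (mean_linear E HE); apply Rle_antisym; (apply mean_mono; [assumption|]);
      intros a; rewrite (mean_linear (F a) (HF a)); lra.
  - intros r.
    transitivity (E (fun _ => r)); [|now apply mean_const].
    apply Rle_antisym; (apply mean_mono; [assumption|]);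
      intros a; rewrite (mean_const (F a) (HF a)); lra.
  - intros g h Hgh; apply mean_mono; [assumption|]; intros a.
    apply mean_mono; [apply HF|]; intros b; apply Hgh.
  - intros v.
    eapply Rle_trans; [apply (mean_centered E HE)|].
    apply mean_mono; [assumption|]; intros a.
    eapply Rle_trans; [apply (mean_centered (F a) (HF a))|].
    apply mean_mono; [apply HF|]; intros b; rewrite vadd_assoc; lra.
Qed.

(* [K x t] is the law of a centered increment started at [x] which raises the
   expected norm by at least [c t], at the cost of a second moment [r t^2]. *)
Definition growing_kernel {X : NormedSpace} (c r : R) (K : X -> R -> (X -> R) -> R) : Prop :=
  forall x t, 0 < t ->
    mean (K x t) /\
    vnorm x + c * t <= K x t (fun a => vnorm (vadd x a)) /\
    K x t (fun a => (vnorm a)^2) <= r * t^2.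

Lemma rough_kernel (X : NormedSpace) (c : R) :
  rough X c -> exists K, @growing_kernel X c 1 K.
Proof.
  intros HR.
  (* Positivity sits under the existential to make the relation total for choice; [vzero] is the
     default at other lengths. *)
  assert (HR' : forall p : X * R, exists y, 0 < snd p -> vnorm y <= 1 /\
    vnorm (fst p) + c * snd p <= (vnorm (vadd (fst p) (vscal (snd p) y)) +
       vnorm (vsub (fst p) (vscal (snd p) y))) / 2).
  { intros [x t]; simpl; destruct (Rlt_dec 0 t) as [Ht|Ht].
    - destruct (HR x t Ht) as [y Hy]; now exists y.
    - exists vzero; lra. }
  destruct (functional_choice _ HR') as [Y HY].
  (* A fair coin decides the sign of the rough direction, which makes the step centered. *)
  exists (fun x t h => (h (vscal t (Y (x, t))) + h (vopp (vscal t (Y (x, t))))) / 2).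
  intros x t Ht; destruct (HY (x, t) Ht) as [Y1 Y2]; simpl in Y2.
  set (y := Y (x, t)) in *.
  split; [split|split].
  - intros; lra.
  - intros; lra.
  - intros g h Hgh.
    assert (P := Hgh (vscal t y)); assert (Q := Hgh (vopp (vscal t y))); lra.
  - intros v.
    assert (T := vnorm_triangle X (vadd v (vscal t y)) (vadd v (vopp (vscal t y)))).
    replace (vadd (vadd v (vscal t y)) (vadd v (vopp (vscal t y)))) with (vscal 2 v) in T by vec.
    rewrite vnorm_scal_pos in T by lra; lra.
  - exact Y2.
  - rewrite vnorm_opp, vnorm_scal_pos by lra.
    assert (N := vnorm_nonneg X y).
    assert ((t * vnorm y)^2 <= (t * 1)^2) by (apply pow_incr; nra); nra.
Qed.

(** By the triangle inequality a norm growth of [c * t] needs a mean step length of at least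
    [c * t]; then square. *)
Lemma growing_kernel_moment (X : NormedSpace) (c r : R) (K : X -> R -> (X -> R) -> R) (x : X) (t : R) :
  0 < c -> 0 < t -> growing_kernel c r K ->
  c^2 * t^2 <= K x t (fun a => (vnorm a)^2).
Proof.
  intros Hc Ht HK; destruct (HK x t Ht) as [HE [Hg _]].
  assert (G := mean_growth_le X _ x HE).
  assert (Q := mean_square X _ vnorm HE).
  assert ((c * t)^2 <= (K x t vnorm)^2) by (apply pow_incr; nra).
  rewrite <- Rpow_mult_distr; lra.
Qed.

(* Two half-size steps [a], [b] in succession: centering makes [|a - b|] large on
   average, so uniform convexity lowers the second moment of [a + b]. *)
Lemma growing_kernel_step (X : NormedSpace) (c : R) :
  uniformly_convex X -> 0 < c -> exists kappa, 0 < kappa /\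
  forall r (K : X -> R -> (X -> R) -> R), r <= 1 -> growing_kernel c r K ->
  exists K', growing_kernel (X := X) c (r - kappa) K'.
Proof.
  intros HU Hc.
  (* With this [eta] the error term costs at most [c^2 * t^2 / 8], as [r <= 1], while centering
     gains at least [c^2 * t^2 / 4]. The net gain [c^2 * t^2 / 8], divided by [L], gives [kappa]. *)
  destruct (uniformly_convex_square X (c^2 / 4) HU) as [L [HL HLin]]; [nra|].
  exists (c^2 / (8 * L)); split; [apply Rdiv_lt_0_compat; nra|].
  intros r K Hr HK.
  exists (fun x t h => K x (t / 2) (fun a => K (vadd x a) (t / 2) (fun b => h (vadd a b)))).
  intros x t Ht.
  assert (Ht2 : 0 < t / 2) by lra.
  destruct (HK x (t / 2) Ht2) as [HE [Hg Hm]].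
  set (E := K x (t / 2)) in *.
  assert (HF : forall a, mean (K (vadd x a) (t / 2))) by (intros a; now apply HK).
  split; [exact (mean_bind X E (fun a => K (vadd x a) (t / 2)) HE HF)|split].
  - apply Rle_trans with (E (fun a => c * (t / 2) + 1 * vnorm (vadd x a))).
    + rewrite mean_linear, mean_const by assumption; lra.
    + apply mean_mono; [assumption|]; intros a.
      destruct (HK (vadd x a) (t / 2) Ht2) as [HFa [Hga _]].
      eapply Rle_trans; [|eapply Rle_trans; [exact Hga|]]; [lra|].
      apply mean_mono; [assumption|]; intros b; rewrite vadd_assoc; lra.
  - set (D := fun a => K (vadd x a) (t / 2) (fun b => (vnorm (vadd a b))^2)).
    assert (HD : forall a, L * D a <=
      (c^2 / 4 + 2 * L) * r * (t / 2)^2 + (c^2 / 4 + 2 * L - 1) * (vnorm a)^2).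
    { intros a; unfold D.
      destruct (HK (vadd x a) (t / 2) Ht2) as [HFa [_ Hma]].
      set (F := K (vadd x a) (t / 2)) in *.
      (* Centering of the second step, tested at [-a], followed by [mean_square]. *)
      assert (HA : (vnorm a)^2 <= F (fun b => (dist a b)^2)).
      { assert (C := mean_centered F HFa (vopp a)); rewrite vnorm_opp in C.
        apply Rle_trans with ((F (fun b => vnorm (vadd (vopp a) b)))^2).
        - apply pow_incr; split; [apply vnorm_nonneg|exact C].
        - eapply Rle_trans; [now apply mean_square|].
          apply mean_mono; [assumption|]; intros b.
          rewrite dist_sym; unfold dist, vsub; rewrite vadd_comm; lra. }
      assert (HB : F (fun b => (dist a b)^2) <=
        F (fun b => ((c^2 / 4 + 2 * L) * (vnorm a)^2 + (c^2 / 4 + 2 * L) * (vnorm b)^2)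
                    + (- L) * (vnorm (vadd a b))^2)).
      { apply mean_mono; [assumption|]; intros b; specialize (HLin a b); nra. }
      rewrite (mean_linear F HFa), (mean_linear F HFa), (mean_const F HFa) in HB.
      assert ((c^2 / 4 + 2 * L) * F (fun b => (vnorm b)^2) <= (c^2 / 4 + 2 * L) * (r * (t / 2)^2))
        by (apply Rmult_le_compat_l; nra).
      lra. }
    assert (HT : L * E D <= (c^2 / 4 + 2 * L) * r * (t / 2)^2
      + (c^2 / 4 + 2 * L - 1) * E (fun a => (vnorm a)^2)).
    { rewrite <- (mean_const E HE ((c^2 / 4 + 2 * L) * r * (t / 2)^2)).
      rewrite <- (mean_linear E HE).
      (* [mean_linear] handles only the shape [g + r * h], so a zero constant is inserted to bring
         [L] under [E]. *)
      rewrite <- (Rplus_0_l (L * E D)), <- (mean_const E HE 0), <- (mean_linear E HE).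
      apply mean_mono; [assumption|]; intros a; specialize (HD a); lra. }
    assert (HL2 := growing_kernel_moment X c r K x (t / 2) Hc Ht2 HK); fold E in HL2.
    fold D.
    set (m := E (fun a => (vnorm a)^2)) in *.
    assert ((c^2 / 4 + 2 * L) * m <= (c^2 / 4 + 2 * L) * (r * (t / 2)^2))
      by (apply Rmult_le_compat_l; nra).
    assert (c^2 * r * t^2 <= c^2 * 1 * t^2).
    { apply Rmult_le_compat_r; [nra|]; apply Rmult_le_compat_l; nra. }
    apply (Rmult_le_reg_l L); [lra|].
    replace (L * ((r - c^2 / (8 * L)) * t^2)) with (L * r * t^2 - c^2 / 8 * t^2) by (field; lra).
    nra.
Qed.

(** After [n] doublings the moment constant is [1 - n * kappa], eventually negative, yet
    [growing_kernel_moment] keeps it at least [c^2]. *)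
Lemma uniformly_convex_not_rough (X : NormedSpace) (c : R) :
  uniformly_convex X -> 0 < c -> ~ rough X c.
Proof.
  intros HU Hc HR.
  destruct (growing_kernel_step X c HU Hc) as [kappa [Hk Hstep]].
  assert (P : forall n, exists K, @growing_kernel X c (1 - INR n * kappa) K).
  { induction n as [|n [K IH]].
    - simpl; rewrite Rmult_0_l, Rminus_0_r; now apply rough_kernel.
    - assert (Hr : 1 - INR n * kappa <= 1).
      { assert (0 <= INR n) by apply pos_INR; nra. }
      destruct (Hstep _ K Hr IH) as [K' HK'].
      exists K'; rewrite S_INR.
      now replace (1 - (INR n + 1) * kappa) with (1 - INR n * kappa - kappa) by ring. }
  destruct (INR_archimed kappa 1 Hk) as [n Hn].
  destruct (P n) as [K HK].
  assert (L := growing_kernel_moment X c _ K vzero 1 Hc Rlt_0_1 HK).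
  destruct (HK vzero 1 Rlt_0_1) as [_ [_ U]].
  nra.
Qed.

(** * Failure of smoothness gives roughness *)

(** By convexity of the norm: [x + t y] lies between [x] and [x + s y], with weight [t / s] on the
    latter. This carries a failure at some small scale up to any larger one. *)
Lemma symmetric_growth_mono (X : NormedSpace) (x y : X) (e s t : R) :
  sphere X x -> 0 < t <= s ->
  e * t < (vnorm (vadd x (vscal t y)) + vnorm (vsub x (vscal t y))) / 2 - 1 ->
  e * s < (vnorm (vadd x (vscal s y)) + vnorm (vsub x (vscal s y))) / 2 - 1.
Proof.
  intros Sx [Ht Hts] H; unfold sphere in Sx.
  set (l := t / s).
  assert (Hl : 0 < l) by (apply Rdiv_lt_0_compat; lra).
  assert (El : t = l * s) by (unfold l; field; lra).
  assert (Hl1 : l <= 1) by (apply (Rmult_le_reg_r s); lra).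
  assert (A : forall z, vnorm (vadd (vscal (1 - l) x) (vscal l z)) <= (1 - l) + l * vnorm z).
  { intros z; eapply Rle_trans; [apply vnorm_triangle|].
    rewrite !vnorm_scal_pos, Sx by lra; lra. }
  assert (A1 := A (vadd x (vscal s y))); assert (A2 := A (vsub x (vscal s y))).
  replace (vadd (vscal (1 - l) x) (vscal l (vadd x (vscal s y))))
    with (vadd x (vscal t y)) in A1 by (rewrite El; vec).
  replace (vadd (vscal (1 - l) x) (vscal l (vsub x (vscal s y))))
    with (vsub x (vscal t y)) in A2 by (rewrite El; vec).
  apply (Rmult_lt_reg_l l); [lra|].
  rewrite El in H at 1; lra.
Qed.

Lemma rough_of_not_smooth (X : NormedSpace) :
  almost_transitive X -> ~ uniformly_smooth X -> exists c, 0 < c /\ rough X c.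
Proof.
  intros HT HS.
  apply not_all_ex_not in HS; destruct HS as [e HS].
  apply imply_to_and in HS; destruct HS as [He HS].
  assert (W : forall s, 0 < s -> exists x y : X, sphere X x /\ sphere X y /\
    e * s < (vnorm (vadd x (vscal s y)) + vnorm (vsub x (vscal s y))) / 2 - 1).
  { intros s Hs; apply NNPP; intros N; apply HS; exists s; split; [exact Hs|].
    intros t Ht x y Sx Sy; apply Rnot_lt_le; intros C; apply N.
    exists x, y; repeat split; auto.
    apply symmetric_growth_mono with t; auto; lra. }
  (* The other half of [e] pays for approximating the normalized [x] by an image [T u] of a bad
     point [u]. *)
  exists (e / 2); split; [lra|].
  intros x t Ht.
  destruct (Rle_lt_or_eq_dec _ _ (vnorm_nonneg X x)) as [Hp|H0].
  - set (n := vnorm x) in *.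
    assert (Hin : 0 < / n) by (now apply Rinv_0_lt_compat).
    assert (Hst : 0 < t / n) by (apply Rdiv_lt_0_compat; lra).
    destruct (W (t / n) Hst) as (u & v & Su & Sv & Huv).
    assert (Hpos : e * (t / n) / 2 > 0) by nra.
    destruct (proj2 (HT u Su (vscal (/ n) x)) (sphere_normalize X x Hp) _ Hpos)
      as [a [[T [[[Ta Ts] [Tn _]] <-]] D]].
    set (x' := vscal (/ n) x) in *.
    exists (T v); split; [rewrite Tn, Sv; lra|].
    assert (E1 : vnorm (vadd x (vscal t (T v))) = n * vnorm (vadd x' (vscal (t / n) (T v)))).
    { rewrite <- vnorm_scal_pos by lra; f_equal; unfold x'; vec. }
    assert (E2 : vnorm (vsub x (vscal t (T v))) = n * vnorm (vsub x' (vscal (t / n) (T v)))).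
    { rewrite <- vnorm_scal_pos by lra; f_equal; unfold x'; vec. }
    rewrite E1, E2.
    assert (F1 := vnorm_le_dist X (T (vadd u (vscal (t / n) v))) (vadd x' (vscal (t / n) (T v)))).
    assert (F2 := vnorm_le_dist X (T (vsub u (vscal (t / n) v))) (vsub x' (vscal (t / n) (T v)))).
    rewrite Tn in F1, F2.
    rewrite linear_map_sub in F2 by (now split).
    rewrite Ta, !Ts in F1; rewrite Ts in F2.
    replace (dist (vadd (T u) (vscal (t / n) (T v))) (vadd x' (vscal (t / n) (T v))))
      with (dist x' (T u)) in F1 by (rewrite dist_sym; unfold dist; f_equal; vec).
    replace (dist (vsub (T u) (vscal (t / n) (T v))) (vsub x' (vscal (t / n) (T v))))
      with (dist x' (T u)) in F2 by (rewrite dist_sym; unfold dist; f_equal; vec).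
    assert (G : 1 + e * (t / n) / 2 <= (vnorm (vadd x' (vscal (t / n) (T v)))
      + vnorm (vsub x' (vscal (t / n) (T v)))) / 2) by lra.
    apply (Rmult_le_compat_l n) in G; [|lra].
    replace (n * (1 + e * (t / n) / 2)) with (n + e / 2 * t) in G by (field; lra).
    lra.
  - symmetry in H0.
    (* At [x = 0] any unit vector gives growth exactly [t]. Scale 1 supplies such a vector and, by
       the triangle inequality, [e < 1]. *)
    destruct (W 1 Rlt_0_1) as (u & v & Su & Sv & Huv).
    unfold sphere in Su, Sv.
    assert (e < 1).
    { assert (P := vnorm_triangle X u (vscal 1 v)).
      assert (Q := vnorm_triangle X u (vopp (vscal 1 v))).
      rewrite vnorm_opp in Q; rewrite vscal_1 in *; unfold vsub in Huv; lra. }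
    exists u; split; [lra|].
    rewrite H0, (vnorm_eq0 X x H0); unfold vsub.
    rewrite !vadd_0_l, vnorm_opp, vnorm_scal_pos, Su by lra; nra.
Qed.

Theorem theorem4 (X : NormedSpace) (HB : BanachSpace X)
  (Hct : convex_transitive X)
  (H : forall eps, eps > 0 ->
     exists (k : nat) (delta c : nat -> R) (f : nat -> X -> R),
       (forall i, (i < k)%nat -> 0 < delta i < 1) /\
       (forall i, (i < k)%nat -> 0 < c i <= 1) /\
       fsum k c = 1 /\
       (forall i, (i < k)%nat -> dual_sphere X (f i)) /\
       (exists y : X, ball X y /\
          forall i, (i < k)%nat -> f i y > 1 - c i * delta i) /\
       diam_lt (fun y : X => ball X y /\
          forall i, (i < k)%nat -> f i y > 1 - 2 * delta i) eps) :
  class_J X.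
Proof.
  assert (HT := almost_transitive_of_slices X Hct H).
  assert (HU := uniformly_convex_of_slices X Hct H).
  split; [exact HT|split; [exact HU|]].
  apply NNPP; intros HS.
  destruct (rough_of_not_smooth X HT HS) as [c [Hc HR]].
  exact (uniformly_convex_not_rough X c HU Hc HR).
Qed.
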